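(* Let $d_1\ge 2$ be a perfect square, let $a_0,b_0\in\mathbb C\setminus\{0\}$, fix a sign, and put $\alpha=\mp2/\sqrt{d_1}$, $c_0=\pm1/\sqrt{d_1}$ (upper signs together or lower signs together), $e_0=1$, $Q=2/\sqrt{d_1}$. Consider the system $$\dot x_1=-2x_1u_1,\qquad \dot x_2=x_2u_2,\qquad \dot u_1=-u_1u_2+\tfrac1{d_1}x_1,\qquad \dot u_2=-d_1u_1^2$$ and the ansatz $$x_1=\sum_{i\ge0}a_it^{\alpha+iQ},\quad x_2=\sum_{i\ge0}b_it^{1+iQ},\quad u_1=\sum_{i\ge0}c_it^{-1+iQ},\quad u_2=\sum_{i\ge0}e_it^{-1+iQ}.$$ Then the compatibility conditions for the associated recursion hold at the top resonance $iQ=2$ (that is, $i=\sqrt{d_1}$). Moreover, exactly one free parameter enters the expansion at this resonance, and this free parameter can be chosen so that the formal series solution lies on $H=0$.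
   Context: With $\iota=iQ$, substituting the ansatz gives for each $i\ge1$ the linear system $X(\iota)(a_i,b_i,c_i,e_i)^T=R_i$, where $$X(\iota)=\begin{pmatrix}\iota&0&2a_0&0\\0&\iota&0&-b_0\\0&0&\iota&\pm1/\sqrt{d_1}\\0&0&\pm2\sqrt{d_1}&\iota-1\end{pmatrix},\qquad R_i=\begin{pmatrix}-2\sum_{k=1}^{i-1}a_{i-k}c_k\\ \sum_{k=1}^{i-1}b_{i-k}e_k\\-\sum_{k=1}^{i-1}c_{i-k}e_k+d_1^{-1}a_{i-\sqrt{d_1}\pm1}\\-d_1\sum_{k=1}^{i-1}c_{i-k}c_k\end{pmatrix},$$ with the convention $a_k=0$ for $k<0$. Resonances are the values of $\iota$ with $\det X(\iota)=0$; the largest one is $\iota=2$. The compatibility conditions at a resonance hold if the right-hand side $R_i$, computed from the previous steps, lies in the image of $X(\iota)$. ''Exactly one free parameter enters'' means that the solution set of the linear system at that step is a one-dimensional affine space. Here $H=-x_2\,(d_1u_1^2-u_2^2+x_1+1)$, and ''lies on $H=0$'' means that $d_1u_1^2-u_2^2+x_1+1=0$ holds identically as a formal series. *)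

(* Defs.v *)
From HB Require Import structures.
From mathcomp Require Export all_boot all_order all_algebra.
From mathcomp Require Export classical_sets fsbigop reals.
From mathcomp Require Export complex.
Set Implicit Arguments.
Unset Strict Implicit.
Unset Printing Implicit Defensive.
Import Order.TTheory GRing.Theory Num.Theory.
Local Open Scope ring_scope.

(* Throughout, s is the natural number sqrt(d1), and up : bool selects the
   upper (true) or the lower (false) signs. *)

Definition pm (up : bool) : int := if up then 1 else -1.

Definition Qexp (s : nat) : rat := 2 / s%:R.

Definition alpha (s : nat) (up : bool) : rat := - (pm up)%:~R * 2 / s%:R.

Definition c_zero (C : numFieldType) (s : nat) (up : bool) : C :=
  (pm up)%:~R / s%:R.

(* w i is the column vector (a_i, b_i, c_i, e_i)^T. *)
Definition coefs (C : numFieldType) := nat -> 'cV[C]_4.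

Definition col4 (C : numFieldType) (x y z t : C) : 'cV[C]_4 :=
  \col_(k < 4) [:: x; y; z; t]`_k.

Definition ca (C : numFieldType) (w : coefs C) (i : nat) : C :=
  w i (@Ordinal 4 0 isT) 0.
Definition cb (C : numFieldType) (w : coefs C) (i : nat) : C :=
  w i (@Ordinal 4 1 isT) 0.
Definition cc (C : numFieldType) (w : coefs C) (i : nat) : C :=
  w i (@Ordinal 4 2 isT) 0.
Definition ce (C : numFieldType) (w : coefs C) (i : nat) : C :=
  w i (@Ordinal 4 3 isT) 0.

Definition zcoef (C : numFieldType) (a : nat -> C) (k : int) : C :=
  if k is Posz n then a n else 0.

Definition Xmat (C : numFieldType) (s : nat) (up : bool) (a0 b0 iota : C) :
    'M[C]_4 :=
  \matrix_(i < 4, j < 4) (nth [::]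
    [:: [:: iota; 0;    2 * a0;                   0                   ];
        [:: 0;    iota; 0;                        - b0                ];
        [:: 0;    0;    iota;                     (pm up)%:~R / s%:R  ];
        [:: 0;    0;    (pm up)%:~R * 2 * s%:R;   iota - 1            ]] i)`_j.

Definition Rvec (C : numFieldType) (d1 s : nat) (up : bool) (w : coefs C)
    (i : nat) : 'cV[C]_4 :=
  col4
    (- 2 * \sum_(1 <= k < i) ca w (i - k) * cc w k)
    (\sum_(1 <= k < i) cb w (i - k) * ce w k)
    (- (\sum_(1 <= k < i) cc w (i - k) * ce w k)
       + d1%:R^-1 * zcoef (ca w) (i%:Z - s%:Z + pm up))
    (- d1%:R * \sum_(1 <= k < i) cc w (i - k) * cc w k).

Definition iota_at (C : numFieldType) (s i : nat) : C :=
  ratr (i%:R * Qexp s).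

Definition initial_data (C : numFieldType) (s : nat) (up : bool) (a0 b0 : C)
    (w : coefs C) : Prop :=
  w 0%N = col4 a0 b0 (c_zero C s up) 1.

Definition step_solution (C : numFieldType) (d1 s : nat) (up : bool)
    (a0 b0 : C) (w : coefs C) (i : nat) (v : 'cV[C]_4) : Prop :=
  Xmat s up a0 b0 (iota_at C s i) *m v = Rvec d1 s up w i.

Definition solved_below (C : numFieldType) (d1 s : nat) (up : bool)
    (a0 b0 : C) (n : nat) (w : coefs C) : Prop :=
  initial_data s up a0 b0 w /\
  forall i, (1 <= i < n)%N -> step_solution d1 s up a0 b0 w i (w i).

Definition solved (C : numFieldType) (d1 s : nat) (up : bool)
    (a0 b0 : C) (w : coefs C) : Prop :=
  initial_data s up a0 b0 w /\
  forall i, (1 <= i)%N -> step_solution d1 s up a0 b0 w i (w i).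

Definition resonance (C : numFieldType) (s : nat) (up : bool) (a0 b0 : C)
    (iota : C) : Prop :=
  \det (Xmat s up a0 b0 iota) = 0.

(* On C = R[i], z <= iota forces z - iota to be real. *)
Definition top_resonance (C : numFieldType) (s : nat) (up : bool) (a0 b0 : C)
    (iota : C) : Prop :=
  resonance s up a0 b0 iota /\
  forall z, resonance s up a0 b0 z -> z <= iota.

Definition compatible_at (C : numFieldType) (d1 s : nat) (up : bool)
    (a0 b0 : C) (w : coefs C) (i : nat) : Prop :=
  exists v : 'cV[C]_4, step_solution d1 s up a0 b0 w i v.

Definition affine_of_dim (C : numFieldType) (n : nat)
    (S : 'cV[C]_4 -> Prop) : Prop :=
  exists (v0 : 'cV[C]_4) (U : {vspace 'cV[C]_4}),
    \dim U = n /\ forall v, S v <-> v - v0 \in U.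

(* Formal series in t with rational exponents: f q is the coefficient of t^q. *)
Definition fseries (C : numFieldType) := rat -> C.

(* The series \sum_(i >= 0) f_i t^(r + i p), for p != 0. *)
Definition ansatz (C : numFieldType) (r p : rat) (f : nat -> C) : fseries C :=
  fun q => if (q - r) / p \is a Num.nat
           then f (Num.truncn ((q - r) / p)) else 0.

Definition fone (C : numFieldType) : fseries C := fun q => (q == 0)%:R.

(* Cauchy product. For two series of the form [ansatz r p f] with the same
   p > 0 the sum has finite support; otherwise an infinite sum would be 0 by
   the convention for \sum_(_ \in _). *)
Definition fmul (C : numFieldType) (f g : fseries C) : fseries C :=
  fun q => \sum_(x \in [set: rat]) f x * g (q - x).

Definition fderiv (C : numFieldType) (f : fseries C) : fseries C :=
  fun q => ratr (q + 1) * f (q + 1).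

Definition solves_system (C : numFieldType) (d1 : nat)
    (x1 x2 u1 u2 : fseries C) : Prop :=
  forall q : rat,
  [/\ fderiv x1 q = - 2 * fmul x1 u1 q,
      fderiv x2 q = fmul x2 u2 q,
      fderiv u1 q = - fmul u1 u2 q + d1%:R^-1 * x1 q
    & fderiv u2 q = - d1%:R * fmul u1 u1 q].

Definition lies_on_H0 (C : numFieldType) (d1 : nat)
    (x1 u1 u2 : fseries C) : Prop :=
  forall q : rat,
    d1%:R * fmul u1 u1 q - fmul u2 u2 q + x1 q + fone C q = 0.

Definition x1_of (C : numFieldType) (s : nat) (up : bool) (w : coefs C) :=
  ansatz (alpha s up) (Qexp s) (ca w).
Definition x2_of (C : numFieldType) (s : nat) (w : coefs C) :=
  ansatz 1 (Qexp s) (cb w).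
Definition u1_of (C : numFieldType) (s : nat) (w : coefs C) :=
  ansatz (-1) (Qexp s) (cc w).
Definition u2_of (C : numFieldType) (s : nat) (w : coefs C) :=
  ansatz (-1) (Qexp s) (ce w).

Definition extends_at (C : numFieldType) (n : nat) (w : coefs C)
    (v : 'cV[C]_4) (w' : coefs C) : Prop :=
  (forall i, (i < n)%N -> w' i = w i) /\ w' n = v.

(* Main.v *)
Require Import Defs.
From mathcomp Require Import all_boot all_order all_algebra.
From mathcomp Require Import classical_sets fsbigop reals complex.
From mathcomp Require Import zify ring lra.
Set Implicit Arguments.
Unset Strict Implicit.
Unset Printing Implicit Defensive.
Import Order.TTheory GRing.Theory Num.Theory.
Local Open Scope ring_scope.

(* The determinant of X(iota) is iota^2 (iota - 2) (iota + 1), so every step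
   other than i = s = sqrt d1 is uniquely solvable. The (c, e)-block has no
   source until a_0 enters, at i = s - 1 (upper sign) or i = s + 1 (lower sign);
   hence the third and fourth entries of R_s vanish, and the solutions at i = s
   form the line e_s = -2 eps s c_s, where eps is the sign.
   The series G = d1 u1^2 - u2^2 + x1 + 1 has zero derivative, so only its
   constant term matters. That term is 6 eps s c_s plus terms fixed by the
   earlier steps, and c_s can be chosen to cancel it. *)

(** * Cauchy products and formal series with rational exponents *)

Section FormalSeries.
Variable C : numFieldType.
Implicit Types (f g : nat -> C) (r p q : rat).

Definition conv f g (n : nat) : C := \sum_(k < n.+1) f (n - k)%N * g k.

Lemma conv0 f g : conv f g 0 = f 0%N * g 0%N.
Proof. by rewrite /conv big_ord1. Qed.

Lemma conv_ends f g i : (0 < i)%N ->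
  conv f g i = f i * g 0%N + f 0%N * g i + \sum_(1 <= k < i) f (i - k)%N * g k.
Proof.
move=> i0; rewrite /conv -(big_mkord xpredT (fun k => f (i - k)%N * g k)).
rewrite big_nat_recr //= big_ltn // subn0 subnn.
by rewrite addrAC.
Qed.

Lemma eq_conv f f' g g' n : (forall k, (k <= n)%N -> f k = f' k) ->
  (forall k, (k <= n)%N -> g k = g' k) -> conv f g n = conv f' g' n.
Proof.
move=> ff' gg'; apply: eq_bigr => k _.
by rewrite ff' ?leq_subr // gg' // -ltnS.
Qed.

(** A delay by [m] is multiplication by the [m]-th power of the variable, so it passes through the
    Cauchy product; the terms with [n - k < m] vanish by the convention of [zcoef]. *)
Lemma conv_zcoef f g (m n : nat) :
  conv (fun k => zcoef f (k%:Z - m%:Z)) g n = zcoef (conv f g) (n%:Z - m%:Z).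
Proof.
have zneg k : (k < m)%N -> zcoef f (k%:Z - m%:Z) = 0.
  by move=> km; have -> : k%:Z - m%:Z = Negz (m - k).-1 by lia.
have [mn|nm] := leqP m n; last first.
  have -> : n%:Z - m%:Z = Negz (m - n).-1 by lia.
  by rewrite /conv big1 // => k _; rewrite zneg ?mul0r //; lia.
rewrite subzn //= /conv.
rewrite -(big_mkord xpredT (fun k => zcoef f ((n - k)%:Z - m%:Z) * g k)).
rewrite -(big_mkord xpredT (fun k => f (n - m - k)%N * g k)).
rewrite (big_cat_nat _ (n := (n - m).+1)) //=; last by lia.
rewrite [X in _ + X]big_nat [X in _ + X]big1 ?addr0.
  apply: eq_big_nat => k km; congr (_ * _).
  by have -> : (n - k)%:Z - m%:Z = (n - m - k)%N by lia.
by move=> k km; rewrite zneg ?mul0r //; lia.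
Qed.

Lemma coef_mul_conv (P1 P2 : {poly C}) n :
  (P1 * P2)`_n = conv (fun k => P1`_k) (fun k => P2`_k) n.
Proof. by rewrite coefMr. Qed.

Lemma ansatz_on r p f n : p != 0 -> ansatz r p f (r + n%:R * p) = f n.
Proof. by move=> p0; rewrite /ansatz addrC addKr mulfK // natr_nat natrK. Qed.

Lemma ansatz_off r p f q : p != 0 -> (forall n, q != r + n%:R * p) ->
  ansatz r p f q = 0.
Proof.
move=> p0 hq; rewrite /ansatz; case: ifPn => // /natrP[n qn].
by have := hq n; rewrite -qn mulfVK // addrC subrK eqxx.
Qed.

(** Identities of series are checked exponent by exponent: on the grid they become recursions, off
    the grid every term is zero. *)
Variant exponent_spec r p q : Prop :=
  | ExponentOn n of q = r + n%:R * p
  | ExponentOff of (forall n, q != r + n%:R * p).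

Lemma exponentP r p q : exponent_spec r p q.
Proof.
have [p0|p0] := eqVneq p 0.
  have [->|qr] := eqVneq q r; first by apply: (@ExponentOn _ _ _ 0); rewrite mul0r addr0.
  by apply: ExponentOff => n; rewrite p0 mulr0 addr0.
case: (boolP ((q - r) / p \is a Num.nat)) => [/natrP[n qn]|qN].
  by apply: (@ExponentOn _ _ _ n); rewrite -qn mulfVK // addrC subrK.
apply: ExponentOff => n; apply: contra qN => /eqP ->.
by rewrite addrC addKr mulfK // natr_nat.
Qed.

Lemma eq_ansatz r p f g : f =1 g -> ansatz r p f =1 ansatz r p g.
Proof. by move=> fg q; rewrite /ansatz; case: ifP. Qed.

(** Lets a series that starts [m] grid points late be read on the earlier grid, with [zcoef]
    supplying the leading zeros. *)
Lemma ansatz_shift r p f (m : nat) q : p != 0 ->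
  ansatz (r + m%:R * p) p f q =
  ansatz r p (fun n => zcoef f (n%:Z - m%:Z)) q.
Proof.
move=> p0; case: (exponentP r p q) => [n ->|hq]; last first.
  rewrite !ansatz_off // => n; have := hq (m + n)%N.
  by rewrite natrD mulrDl addrA.
rewrite ansatz_on //; have [mn|nm] := leqP m n.
  rewrite subzn //= -{1}(subnKC mn) natrD mulrDl addrA.
  by rewrite ansatz_on.
have -> : n%:Z - m%:Z = Negz (m - n).-1 by lia.
rewrite /= ansatz_off // => k; rewrite -addrA -mulrDl -natrD.
rewrite (inj_eq (addrI r)) (inj_eq (mulIf p0)) eqr_nat.
by lia.
Qed.

Lemma fderiv_ansatz r p f q : p != 0 ->
  fderiv (ansatz r p f) q =
  ansatz (r - 1) p (fun n => ratr (r + n%:R * p) * f n) q.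
Proof.
move=> p0; case: (exponentP (r - 1) p q) => [n ->|hq]; rewrite /fderiv.
  have -> : r - 1 + n%:R * p + 1 = r + n%:R * p by ring.
  by rewrite !ansatz_on.
rewrite !ansatz_off ?mulr0 // => n; apply: contra (hq n) => /eqP e.
by rewrite addrAC -e addrK.
Qed.

Lemma fmul_ansatz r1 r2 p f g q : p != 0 ->
  fmul (ansatz r1 p f) (ansatz r2 p g) q = ansatz (r1 + r2) p (conv f g) q.
Proof.
move=> p0; rewrite /fmul; case: (exponentP (r1 + r2) p q) => [n ->|hq]; last first.
  rewrite [RHS]ansatz_off // fsbig1 // => x _.
  case: (exponentP r1 p x) => [k ->|hx]; last by rewrite ansatz_off ?mul0r.
  rewrite [X in _ * X]ansatz_off ?mulr0 // => m.
  apply: contra (hq (k + m)%N) => /eqP e; apply/eqP.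
  by rewrite -(subrK (r1 + k%:R * p) q) e natrD; ring.
rewrite ansatz_on //.
(* [h k] is the exponent in the first factor that pairs with term [k] of the second; at any other
   point one of the two factors is zero, so the sum over all rationals is finite. *)
pose h (k : nat) := r1 + (n - k)%:R * p.
have h_inj : {in iota 0 n.+1 &, injective h}.
  move=> i j; rewrite !mem_iota => hi hj /addrI /(mulIf p0) /eqP.
  by rewrite eqr_nat => /eqP; lia.
have h_uniq : uniq (map h (iota 0 n.+1)) by rewrite map_inj_in_uniq ?iota_uniq.
rewrite (fsbigE (map h (iota 0 n.+1))) //; last first.
  move=> x _ hx; case: (exponentP r1 p x) => [k xk|hx']; last by rewrite ansatz_off ?mul0r.
  rewrite [X in _ * X]ansatz_off ?mulr0 // => m; apply: contra hx => /eqP e.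
  have nkm : n = (k + m)%N.
    apply/eqP; rewrite -(@eqr_nat rat) -(inj_eq (mulIf p0)); apply/eqP.
    by rewrite natrD mulrDl; move: e; rewrite xk => e; lra.
  by apply/mapP; exists m; rewrite ?mem_iota /h ?nkm ?addnK //; lia.
under eq_bigl do rewrite in_setT.
rewrite big_map /conv -(big_mkord xpredT (fun k => f (n - k)%N * g k)).
rewrite /index_iota subn0 !big_seq; apply: eq_bigr => k; rewrite mem_iota => hk.
rewrite /h ansatz_on //; congr (_ * _).
have -> : r1 + r2 + n%:R * p - (r1 + (n - k)%:R * p) = r2 + k%:R * p.
  by rewrite natrB; [ring | lia].
by rewrite ansatz_on.
Qed.

End FormalSeries.

(** * The matrix of the recursion and its determinant *)

Section Matrix.
Variable C : numFieldType.
Implicit Types (a b x y z t iota : C) (v : 'cV[C]_4).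

Lemma col4P x y z t x' y' z' t' :
  col4 x y z t = col4 x' y' z' t' <-> [/\ x = x', y = y', z = z' & t = t'].
Proof.
split => [/matrixP e|[-> -> -> ->] //].
by split; [have := e (@Ordinal 4 0 isT) 0 | have := e (@Ordinal 4 1 isT) 0
  | have := e (@Ordinal 4 2 isT) 0 | have := e (@Ordinal 4 3 isT) 0];
  rewrite !mxE.
Qed.

Lemma col4_eta v : v = col4 (v (@Ordinal 4 0 isT) 0) (v (@Ordinal 4 1 isT) 0)
  (v (@Ordinal 4 2 isT) 0) (v (@Ordinal 4 3 isT) 0).
Proof.
apply/matrixP => i j; rewrite ord1 mxE.
by case: i => [[|[|[|[|]]]] hi] //=; congr (v _ _); apply: val_inj.
Qed.

Lemma Xmat_col4 s up a b iota x y z t :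
  Xmat s up a b iota *m col4 x y z t =
  col4 (iota * x + 2 * a * z) (iota * y - b * t)
    (iota * z + (pm up)%:~R / s%:R * t)
    ((pm up)%:~R * 2 * s%:R * z + (iota - 1) * t).
Proof.
apply/matrixP => i j; rewrite !mxE !big_ord_recl big_ord0 !mxE /=.
by case: i => [[|[|[|[|]]]] hi] //=; ring.
Qed.

Lemma pm_sq up : (pm up)%:~R * (pm up)%:~R = 1 :> C.
Proof. by case: up => /=; rewrite ?mulrNN mulr1. Qed.

(** The matrix is block triangular: the first two rows contribute [iota ^+ 2], and the lower block
    contributes [iota * (iota - 1) - 2], the signs disappearing because their square is 1. *)
Lemma det_Xmat s up a b iota : (0 < s)%N ->
  \det (Xmat s up a b iota) = iota ^+ 2 * ((iota - 2) * (iota + 1)).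
Proof.
move=> s0.
have sN0 : s%:R != 0 :> C by rewrite pnatr_eq0 -lt0n.
rewrite (expand_det_col _ ord0) !big_ord_recl big_ord0 !mxE /= !mul0r !addr0.
rewrite /cofactor (expand_det_col _ ord0) !big_ord_recl big_ord0 !mxE /= !mul0r !addr0.
rewrite /cofactor (expand_det_col _ ord0) !big_ord_recl big_ord0 !mxE /= !addr0.
rewrite /cofactor !det_mx11 !mxE /=.
have := pm_sq up; move: (_%:~R) => e; rewrite -expr2 => ee.
rewrite !expr0 !mul1r.
by field: ee.
Qed.

End Matrix.

(** * The conserved quantity, by truncation to polynomials *)

Section ConservedQuantity.
Variable C : numFieldType.
Implicit Types (f g : nat -> C).

(** Turns a congruence of truncated series into an equation with an explicit remainder, which [ring]
    can then combine with others. *)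
Lemma eq_coef_upto (P1 P2 : {poly C}) n :
  (forall k, (k <= n)%N -> P1`_k = P2`_k) ->
  exists r, P1 = P2 + 'X^(n.+1) * r.
Proof.
move=> e; exists (drop_poly n.+1 (P1 - P2)).
rewrite -[LHS](subrK P2) addrC; congr (_ + _).
rewrite -[LHS](poly_take_drop n.+1) mulrC.
suff -> : take_poly n.+1 (P1 - P2) = 0 by rewrite add0r.
apply/polyP => k; rewrite coef_take_poly coef0 coefB ltnS.
by case: ifP => // /e ->; rewrite subrr.
Qed.

(* With [D f n = n * Q * f n], a derivation for the Cauchy product, the
   hypotheses read [D c = c - c e + A/d], [D e = e - d c^2], [D A = 2 A - 2 A c],
   and these cancel in [(D - 2) (d c^2 - e^2 + A)]. *)
Lemma conserved_coef (Q d : C) (c e A : nat -> C) : d != 0 ->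
  (forall n, (n%:R * Q - 1) * c n = - conv c e n + d^-1 * A n) ->
  (forall n, (n%:R * Q - 1) * e n = - d * conv c c n) ->
  (forall n, (n%:R * Q - 2) * A n = - 2 * conv A c n) ->
  forall n, (n%:R * Q - 2) * (d * conv c c n - conv e e n + A n) = 0.
Proof.
move=> d0 Hc He HA n.
pose P f : {poly C} := \poly_(k < n.+1) f k.
pose D (p : {poly C}) := Q%:P * ('X * p^`()).
have PE f k : (k <= n)%N -> (P f)`_k = f k by rewrite coef_poly ltnS => ->.
have PPE f g k : (k <= n)%N -> (P f * P g)`_k = conv f g k.
  move=> kn; rewrite coef_mul_conv; apply: eq_conv => j jk; apply: PE; lia.
have DE p k : (D p)`_k = k%:R * Q * p`_k.
  rewrite coefCM coefXM; case: k => [|k] /=; first by rewrite !mul0r mulr0.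
  by rewrite coef_deriv -mulr_natr; ring.
have [rc Ec] : exists r, D (P c) = P c - P c * P e + d^-1%:P * P A + 'X^(n.+1) * r.
  apply: eq_coef_upto => k kn; rewrite DE !coefD coefN coefCM PPE // !PE //.
  by rewrite -addrA -Hc; ring.
have [re Ee] : exists r, D (P e) = P e - d%:P * (P c * P c) + 'X^(n.+1) * r.
  apply: eq_coef_upto => k kn; rewrite DE !coefD coefN coefCM PPE // !PE //.
  by rewrite -mulNr -He; ring.
have [rA EA] : exists r, D (P A) = 2%:P * P A - 2%:P * (P A * P c) + 'X^(n.+1) * r.
  apply: eq_coef_upto => k kn; rewrite DE !coefD coefN !coefCM PPE // !PE //.
  by rewrite -mulNr -HA; ring.
pose G := d%:P * (P c * P c) - P e * P e + P A.
(* The main terms cancel, so only the three truncation remainders survive; they are multiples of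
   ['X^(n.+1)] and do not reach coefficient [n]. *)
have DG : D G - 2%:P * G = 'X^(n.+1) *
    (d%:P * (2%:P * (P c * rc)) - 2%:P * (P e * re) + rA).
  have -> : D G = d%:P * (2%:P * (P c * D (P c))) - 2%:P * (P e * D (P e)) + D (P A).
    rewrite /D /G !derivD derivN !derivM !derivC.
    by rewrite (_ : 2%:P = 2 :> {poly C}) ?polyCMn //; ring.
  have dd : d%:P * d^-1%:P = 1 :> {poly C} by rewrite -polyCM mulfV.
  rewrite Ec Ee EA /G (_ : 2%:P = 2 :> {poly C}) ?polyCMn //.
  move: dd; move: (d^-1%:P) (d%:P) => di dp dd.
  by ring: dd.
have := congr1 (fun p : {poly C} => p`_n) DG.
rewrite /= coefXnM ltnS leqnn coefB DE coefCM => <-.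
by rewrite /G !coefD coefN coefCM !PPE // PE //; ring.
Qed.

End ConservedQuantity.

(** * Solving the recursion away from the top resonance *)

Section Recursion.
Variables (C : numFieldType) (d1 s : nat) (up : bool) (a0 b0 : C).
Hypotheses (s_gt1 : (1 < s)%N) (d1E : d1 = (s ^ 2)%N).
Implicit Types (w : coefs C) (v : 'cV[C]_4).

Local Notation eps := ((pm up)%:~R : C).
Local Notation iota i := (iota_at C s i).

Let s_neq0 : s%:R != 0 :> C. Proof. by rewrite pnatr_eq0; lia. Qed.
Let sQ_neq0 : s%:R != 0 :> rat. Proof. by rewrite pnatr_eq0; lia. Qed.
Let d1_sq : d1%:R = s%:R ^+ 2 :> C. Proof. by rewrite d1E natrX. Qed.
Let eps_sq : eps ^+ 2 = 1. Proof. by rewrite expr2 pm_sq. Qed.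
Let eps_neq0 : eps != 0. Proof. by rewrite -sqrf_eq0 eps_sq oner_neq0. Qed.

Lemma iota_atE i : iota i = i%:R * (2 / s%:R).
Proof. by rewrite /iota_at /Qexp rmorphM fmorph_div /= !ratr_nat. Qed.

Lemma iota_at_top : iota s = 2.
Proof. by rewrite iota_atE mulrCA divff ?mulr1. Qed.

Lemma iota_at_gt0 i : (0 < i)%N -> 0 < iota i.
Proof. by move=> i0; rewrite iota_atE mulr_gt0 ?divr_gt0 ?ltr0n //; lia. Qed.

(** For positive [i] the number [iota i] is positive, and being linear in [i] it takes the value 2
    only at [s]; so no factor of the determinant vanishes. *)
Lemma Xmat_unit i : (0 < i)%N -> i != s ->
  Xmat s up a0 b0 (iota i) \in unitmx.
Proof.
move=> i0 isN; have ip := iota_at_gt0 i0; rewrite unitmxE unitfE det_Xmat; last by lia.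
apply: mulf_neq0; first by rewrite expf_neq0 // lt0r_neq0.
apply: mulf_neq0; last by rewrite lt0r_neq0 // addr_gt0.
rewrite subr_eq0 -iota_at_top !iota_atE (inj_eq (mulIf _)) ?eqr_nat //.
by rewrite mulf_neq0 ?invr_neq0 // pnatr_eq0.
Qed.

Lemma step_solutionP w i x y z t :
  step_solution d1 s up a0 b0 w i (col4 x y z t) <->
  [/\ iota i * x + 2 * a0 * z = - 2 * \sum_(1 <= k < i) ca w (i - k) * cc w k,
      iota i * y - b0 * t = \sum_(1 <= k < i) cb w (i - k) * ce w k,
      iota i * z + eps / s%:R * t = - (\sum_(1 <= k < i) cc w (i - k) * ce w k)
        + d1%:R^-1 * zcoef (ca w) (i%:Z - s%:Z + pm up)
    & eps * 2 * s%:R * z + (iota i - 1) * t =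
        - d1%:R * \sum_(1 <= k < i) cc w (i - k) * cc w k].
Proof. by rewrite /step_solution Xmat_col4; exact: col4P. Qed.

Lemma step_solutionE w i : step_solution d1 s up a0 b0 w i (w i) <->
  [/\ iota i * ca w i + 2 * a0 * cc w i = - 2 * \sum_(1 <= k < i) ca w (i - k) * cc w k,
      iota i * cb w i - b0 * ce w i = \sum_(1 <= k < i) cb w (i - k) * ce w k,
      iota i * cc w i + eps / s%:R * ce w i = - (\sum_(1 <= k < i) cc w (i - k) * ce w k)
        + d1%:R^-1 * zcoef (ca w) (i%:Z - s%:Z + pm up)
    & eps * 2 * s%:R * cc w i + (iota i - 1) * ce w i =
        - d1%:R * \sum_(1 <= k < i) cc w (i - k) * cc w k].
Proof. by rewrite {1}(col4_eta (w i)); exact: step_solutionP. Qed.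

(** Since [s] is at least 2, the index [i - s + pm up] is below [i] for both signs, so the source
    term only reads earlier steps. *)
Lemma zcoef_lt w w' i : (0 < i)%N -> (forall k, (k < i)%N -> w k = w' k) ->
  zcoef (ca w) (i%:Z - s%:Z + pm up) = zcoef (ca w') (i%:Z - s%:Z + pm up).
Proof.
move=> i0 ww'; have : i%:Z - s%:Z + pm up < i%:Z by rewrite /pm; case: up; lia.
by case: (_ + pm up) => //= n ni; rewrite /ca ww' //; lia.
Qed.

Lemma Rvec_ext w w' i : (0 < i)%N -> (forall k, (k < i)%N -> w k = w' k) ->
  Rvec d1 s up w i = Rvec d1 s up w' i.
Proof.
move=> i0 ww'; rewrite /Rvec (zcoef_lt i0 ww').
have E1 k : (1 <= k < i)%N -> w k = w' k by move=> ki; apply: ww'; lia.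
have E2 k : (1 <= k < i)%N -> w (i - k)%N = w' (i - k)%N by move=> ki; apply: ww'; lia.
by congr (col4 (_ * _) _ (- _ + _) (_ * _)); apply: eq_big_nat => k ki;
  rewrite /ca /cb /cc /ce (E1 _ ki) (E2 _ ki).
Qed.

(** Used with [n = 1] to reach the resonance and with [n = s + 1] to continue beyond it. *)
Lemma recursion_extension n w : (0 < n)%N -> exists w',
  (forall i, (i < n)%N -> w' i = w i) /\
  forall i, (n <= i)%N -> i != s -> step_solution d1 s up a0 b0 w' i (w' i).
Proof.
move=> n0.
(* [W m] is the family after the steps below [m] have been treated, and [w'] reads each entry once
   it is final. At the excluded index [s] the entry written by [next] is a default value. *)
pose next i (u : coefs C) : coefs C := fun j =>
  if (j == i) && (n <= i)%N
  then invmx (Xmat s up a0 b0 (iota i)) *m Rvec d1 s up u i else u j.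
pose W := fix W m : coefs C := if m is m'.+1 then next m' (W m') else w.
pose w' : coefs C := fun j => W j.+1 j.
have WE m j : (j < m)%N -> W m j = w' j.
  elim: m => // m IH; rewrite ltnS leq_eqVlt => /orP[/eqP -> //|jm].
  by rewrite /= /next (ltn_eqF jm) /= IH.
have W0 m j : (j < n)%N || (m <= j)%N -> W m j = w j.
  elim: m => // m IH jm; rewrite /= /next; case: ifP => [/andP[/eqP ? ?]|_].
    by subst j; move: jm; lia.
  by rewrite IH //; lia.
exists w'; split => [i ilt|i ni isN]; first by rewrite /w' W0 ?ilt.
rewrite /step_solution {1}/w' /= /next eqxx ni /=.
rewrite mulKVmx; last by apply: Xmat_unit; lia.
by apply: Rvec_ext => [|k ki]; [lia | exact: WE].
Qed.

Lemma solved_below_exists : exists w, solved_below d1 s up a0 b0 s w.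
Proof.
have [w [w0 ws]] :=
  @recursion_extension 1 (fun=> col4 a0 b0 (c_zero C s up) 1) isT.
exists w; split; first exact: w0.
by move=> i /andP[i1 is_]; apply: ws => //; rewrite ltn_eqF.
Qed.

(** * The linear system at the top resonance *)

Section Below.
Variables (w : coefs C) (w_solved : solved_below d1 s up a0 b0 s w).

(** By strong induction all products on the right vanish, and the source index is negative; the (c,
    e)-block is then homogeneous, with nonzero determinant below [s]. *)
Lemma cc_ce_eq0 i : (0 < i < s)%N -> i%:Z - s%:Z + pm up < 0 ->
  cc w i = 0 /\ ce w i = 0.
Proof.
elim/ltn_ind: i => i IH ilt ineg.
have S0 (f g : nat -> C) : (forall k, (0 < k < i)%N -> g k = 0) ->
    \sum_(1 <= k < i) f (i - k)%N * g k = 0.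
  by move=> g0; rewrite big_nat big1 // => k /g0 ->; rewrite mulr0.
have c0 k : (0 < k < i)%N -> cc w k = 0 by move=> ki; apply IH; lia.
have e0 k : (0 < k < i)%N -> ce w k = 0 by move=> ki; apply IH; lia.
have [_ _] := (step_solutionE _ _).1 (w_solved.2 _ ilt).
have -> : zcoef (ca w) (i%:Z - s%:Z + pm up) = 0 by move: ineg; case: (_ + _).
rewrite !S0 // oppr0 !mulr0 addr0 => E3 E4.
have i0 : (0 < i)%N by lia.
(* Cramer's rule: this combination of rows three and four eliminates [e_i] and leaves the block
   determinant times [c_i]. *)
have E : (iota i - 2) * (iota i + 1) * cc w i = 0.
  have -> : (iota i - 2) * (iota i + 1) * cc w i =
    (iota i - 1) * (iota i * cc w i + eps / s%:R * ce w i) -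
    eps / s%:R * (eps * 2 * s%:R * cc w i + (iota i - 1) * ce w i).
    by field: eps_sq.
  by rewrite E3 E4 !mulr0 subr0.
have: Xmat s up a0 b0 (iota i) \in unitmx by apply: Xmat_unit; lia.
rewrite unitmxE unitfE det_Xmat; last by lia.
rewrite mulf_eq0 negb_or => /andP[_ nz].
have ci : cc w i = 0 by apply: (mulfI nz); rewrite mulr0.
split=> //; move/eqP: E3; rewrite ci mulr0 add0r mulf_eq0.
by rewrite (negPf (mulf_neq0 eps_neq0 (invr_neq0 s_neq0))) => /eqP.
Qed.

(** The preceding vanishing misses only [s = 2] with the upper sign, where [a_0] enters at step 1.
    There [iota 1 = 1], so [e_1] drops out of the fourth row, which forces [c_1] to vanish. *)
Lemma cc1_eq0 : cc w 1 = 0.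
Proof.
have [s3|s2] : (1%:Z - s%:Z + pm up < 0) \/ s = 2%N /\ up by rewrite /pm; case: up; lia.
  by apply cc_ce_eq0 => //; lia.
have [_ _ _] := (step_solutionE _ _).1 (w_solved.2 1%N s_gt1).
rewrite big_geq // mulr0 iota_atE s2.1 mul1r divff ?pnatr_eq0 // subrr mul0r addr0.
move/eqP; rewrite mulf_eq0 (negPf (mulf_neq0 _ _)) ?pnatr_eq0 //; first by move/eqP.
by rewrite mulf_neq0 ?pnatr_eq0.
Qed.

Lemma ca1_eq0 : ca w 1 = 0.
Proof.
have [+ _ _ _] := (step_solutionE _ _).1 (w_solved.2 1%N s_gt1).
rewrite big_geq // cc1_eq0 !mulr0 addr0 => /eqP.
by rewrite mulf_eq0 (gt_eqF (iota_at_gt0 _)) //= => /eqP.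
Qed.

(** The index is 1 for the upper sign, giving [a_1], and -1 for the lower sign, where [zcoef] is
    zero by convention. *)
Lemma zcoef_top : zcoef (ca w) (s%:Z - s%:Z + pm up) = 0.
Proof. by rewrite subrr add0r /pm; case: up => //=; exact: ca1_eq0. Qed.

(* At [i = s - 1] a nonzero source [a_0 / d1] may appear, but it can only meet
   itself at step [s] if [s = 2], and then [c_1 = 0]. *)
Lemma cc_conv_top (g : nat -> C) :
  (forall k, (0 < k < s)%N -> k%:Z - s%:Z + pm up < 0 -> g k = 0) ->
  \sum_(1 <= k < s) cc w (s - k) * g k = 0.
Proof.
move=> g0; rewrite big_nat big1 // => k ks.
have [kn|kp] := ltrP (k%:Z - s%:Z + pm up) 0; first by rewrite g0 ?mulr0.
have -> : (s - k)%N = 1%N by move: kp; rewrite /pm; case: up; lia.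
by rewrite cc1_eq0 mul0r.
Qed.

(** Rows three and four have zero right-hand sides, and at [iota = 2] row three is [eps / s] times
    row four. Hence the system is compatible and [z], the value of [c_s], is free; it determines
    [e_s], and then rows one and two give [a_s] and [b_s]. *)
Lemma top_solutionP x y z t :
  step_solution d1 s up a0 b0 w s (col4 x y z t) <->
  [/\ x = - (\sum_(1 <= k < s) ca w (s - k) * cc w k) - a0 * z,
      y = (\sum_(1 <= k < s) cb w (s - k) * ce w k) / 2 - eps * s%:R * b0 * z
    & t = - 2 * eps * s%:R * z].
Proof.
rewrite step_solutionP zcoef_top !cc_conv_top; last 2 first.
- by move=> k ks kn; have [] := cc_ce_eq0 ks kn.
- by move=> k ks kn; have [] := cc_ce_eq0 ks kn.
rewrite iota_at_top oppr0 !mulr0 addr0.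
have two0 : 2 != 0 :> C by rewrite pnatr_eq0.
set S1 := \sum_(_ <= _ < _) _; set S2 := \sum_(_ <= _ < _) _.
split=> [[E1 E2 _ E4]|[-> -> ->]]; last first.
  by split; field: eps_sq; rewrite ?s_neq0.
have tE : t = - 2 * eps * s%:R * z.
  rewrite [LHS](_ : t = eps * 2 * s%:R * z + (2 - 1) * t - eps * 2 * s%:R * z).
    by rewrite E4; ring.
  by ring.
split=> //; apply: (mulfI two0).
  have -> : 2 * x = (2 * x + 2 * a0 * z) - 2 * a0 * z by ring.
  by rewrite E1; ring.
have -> : 2 * y = (2 * y - b0 * t) + b0 * t by ring.
by rewrite E2 tE; field.
Qed.

Definition top_solution (z : C) : 'cV[C]_4 :=
  col4 (- (\sum_(1 <= k < s) ca w (s - k) * cc w k) - a0 * z)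
    ((\sum_(1 <= k < s) cb w (s - k) * ce w k) / 2 - eps * s%:R * b0 * z)
    z (- 2 * eps * s%:R * z).

Lemma top_solution_step z : step_solution d1 s up a0 b0 w s (top_solution z).
Proof. exact/top_solutionP. Qed.

Lemma top_solution_affine : affine_of_dim 1 (step_solution d1 s up a0 b0 w s).
Proof.
(* [u] spans the kernel of the matrix at [iota = 2], normalised to have c-entry 1. *)
pose u : 'cV[C]_4 := col4 (- a0) (- (eps * s%:R * b0)) 1 (- 2 * eps * s%:R).
have uE z : top_solution z = top_solution 0 + z *: u.
  apply/matrixP => i j; rewrite !mxE.
  by case: i => [[|[|[|[|]]]] hi] //=; ring.
exists (top_solution 0), <[u]>%VS; split.
  rewrite dim_vline; suff -> : u != 0 by [].
  apply/eqP => /matrixP/(_ (@Ordinal 4 2 isT) 0); rewrite !mxE /= => /eqP.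
  by rewrite oner_eq0.
move=> v; split=> [|/vlineP[z vz]].
  rewrite (col4_eta v) => /top_solutionP[-> -> ->].
  apply/vlineP; exists (v (@Ordinal 4 2 isT) 0).
  by rewrite -/(top_solution _) uE addrC addKr.
by rewrite -[v](subrK (top_solution 0)) vz addrC -uE; exact: top_solution_step.
Qed.

End Below.

(** * From a solved recursion to a formal solution of the system *)

Section Solved.
Variables (w : coefs C) (w_solved : solved d1 s up a0 b0 w).

Lemma initialE : [/\ ca w 0 = a0, cb w 0 = b0, cc w 0 = eps / s%:R & ce w 0 = 1].
Proof. by rewrite /ca /cb /cc /ce w_solved.1; split; rewrite mxE. Qed.

(** The coefficients of [x1] reindexed on the exponents [-2 + n * Q], the grid of the products of
    [u1] and [u2]. *)
Definition shifted_ca (n : nat) : C := zcoef (ca w) (n%:Z - s%:Z + pm up).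

(** The linear system separates the end terms of the Cauchy product from the rest; restoring them
    gives the coefficient form of the differential equation, with factor [alpha + n * Q]. The case
    [n = 0] is the leading balance. The next three recursions arise in the same way. *)
Lemma ca_recursion n : (iota n - 2 * (eps / s%:R)) * ca w n =
  - 2 * conv (ca w) (cc w) n.
Proof.
have [a_ b_ c_ e_] := initialE; case: n => [|n].
  by rewrite conv0 iota_atE c_ mul0r sub0r; ring.
have [E _ _ _] := (step_solutionE _ _).1 (w_solved.2 n.+1 isT).
by rewrite conv_ends // !mulrDr -E a_ c_; ring.
Qed.

Lemma cb_recursion n : (1 + iota n) * cb w n = conv (cb w) (ce w) n.
Proof.
have [a_ b_ c_ e_] := initialE; case: n => [|n].
  by rewrite conv0 iota_atE e_ mul0r; ring.
have [_ E _ _] := (step_solutionE _ _).1 (w_solved.2 n.+1 isT).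
by rewrite conv_ends // -E b_ e_; ring.
Qed.

Lemma cc_recursion n : (iota n - 1) * cc w n =
  - conv (cc w) (ce w) n + d1%:R^-1 * shifted_ca n.
Proof.
have [a_ b_ c_ e_] := initialE; case: n => [|n].
  rewrite conv0 iota_atE e_ mul0r /shifted_ca.
  (* For [s] at least 2, [x1] does not contribute to the leading balance of [u1]. *)
  have : 0%:Z - s%:Z + pm up < 0 by rewrite /pm; case: up; lia.
  by case: (_ + _) => //= ? _; ring.
have [_ _ E _] := (step_solutionE _ _).1 (w_solved.2 n.+1 isT).
by rewrite conv_ends // opprD -addrA -E c_ e_; ring.
Qed.

Lemma ce_recursion n : (iota n - 1) * ce w n = - d1%:R * conv (cc w) (cc w) n.
Proof.
have [a_ b_ c_ e_] := initialE; case: n => [|n].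
  by rewrite conv0 iota_atE c_ e_ mul0r d1_sq; field: eps_sq.
have [_ _ _ E] := (step_solutionE _ _).1 (w_solved.2 n.+1 isT).
by rewrite conv_ends // mulrDr -E c_ d1_sq; field.
Qed.

(** The number of grid steps from the exponent -2 up to [alpha]. *)
Definition ca_shift : nat := if up then s.-1 else s.+1.

Lemma ca_shiftE (n : nat) : n%:Z - s%:Z + pm up = n%:Z - ca_shift%:Z.
Proof. by rewrite /ca_shift /pm; case: up; lia. Qed.

Lemma alpha_shift : alpha s up = -2 + ca_shift%:R * Qexp s.
Proof.
rewrite /alpha /Qexp /ca_shift /pm; case: up.
  by rewrite -subn1 natrB; [field | lia].
by rewrite -addn1 natrD; field.
Qed.

Lemma iota_shift : iota ca_shift - 2 = - 2 * (eps / s%:R).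
Proof.
rewrite iota_atE /ca_shift /pm; case: up.
  by rewrite -subn1 natrB; [field | lia].
by rewrite -addn1 natrD; field.
Qed.

(** Reindexing leaves the actual exponent unchanged, so the factor [alpha + k * Q] reads
    [n * Q - 2]; this is the form that [conserved_coef] expects. *)
Lemma shifted_ca_recursion n : (iota n - 2) * shifted_ca n =
  - 2 * conv shifted_ca (cc w) n.
Proof.
have -> : conv shifted_ca (cc w) n =
    zcoef (conv (ca w) (cc w)) (n%:Z - ca_shift%:Z).
  rewrite -conv_zcoef; apply: eq_conv => // k _.
  by rewrite /shifted_ca ca_shiftE.
rewrite /shifted_ca ca_shiftE; have [mn|nm] := leqP ca_shift n; last first.
  have -> : n%:Z - ca_shift%:Z = Negz (ca_shift - n).-1 by lia.
  by rewrite /= !mulr0.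
rewrite subzn //= -ca_recursion; congr (_ * _).
have -> : iota n = iota ca_shift + iota (n - ca_shift)%N.
  by rewrite !iota_atE -mulrDl -natrD subnKC.
by rewrite addrAC iota_shift; ring.
Qed.

Lemma Qexp_neq0 : Qexp s != 0.
Proof. by rewrite /Qexp mulf_neq0 ?invr_neq0. Qed.

Lemma x1_of_shift : x1_of s up w =1 ansatz (-2) (Qexp s) shifted_ca.
Proof.
move=> q; rewrite /x1_of alpha_shift ansatz_shift ?Qexp_neq0 //.
by apply: eq_ansatz => n; rewrite /shifted_ca ca_shiftE.
Qed.

Lemma solved_solves_system :
  solves_system d1 (x1_of s up w) (x2_of s w) (u1_of s w) (u2_of s w).
Proof.
have Q0 := Qexp_neq0; move=> q.
rewrite x1_of_shift /x1_of /x2_of /u1_of /u2_of.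
rewrite !fderiv_ansatz // !fmul_ansatz //.
rewrite (_ : -1 - 1 = -2 :> rat) //.
split.
- case: (exponentP (alpha s up - 1) (Qexp s) q) => [n ->|hq].
    rewrite !ansatz_on // -ca_recursion; congr (_ * _).
    rewrite rmorphD /= -/(iota n) addrC /alpha; congr (_ + _).
    rewrite !rmorphM /= fmorphV /= rmorphN /= ratr_int !ratr_nat.
    by ring.
  by rewrite !ansatz_off // mulr0.
- apply: eq_ansatz => n.
  by rewrite -cb_recursion rmorphD /= rmorph1.
- case: (exponentP (-2) (Qexp s) q) => [n ->|hq].
    rewrite !ansatz_on // -cc_recursion; congr (_ * _).
    by rewrite rmorphD /= rmorphN1 addrC.
  by rewrite !ansatz_off // mulr0 oppr0 addr0.
case: (exponentP (-2) (Qexp s) q) => [n ->|hq].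
  rewrite !ansatz_on // -ce_recursion; congr (_ * _).
  by rewrite rmorphD /= rmorphN1 addrC.
by rewrite !ansatz_off // mulr0.
Qed.

(** Conservation kills each coefficient whose exponent [n * Q - 2] is nonzero. The constant term, at
    [n = s], is what the hypothesis controls. *)
Lemma solved_lies_on_H0 :
  d1%:R * conv (cc w) (cc w) s - conv (ce w) (ce w) s + shifted_ca s + 1 = 0 ->
  lies_on_H0 d1 (x1_of s up w) (u1_of s w) (u2_of s w).
Proof.
move=> Hs q; have Q0 := Qexp_neq0.
rewrite x1_of_shift /u1_of /u2_of !fmul_ansatz //.
rewrite (_ : -1 + -1 = -2 :> rat) //.
have topE : -2 + s%:R * Qexp s = 0 by rewrite /Qexp; field.
case: (exponentP (-2) (Qexp s) q) => [n ->|hq]; last first.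
  have qN0 : q != 0 by rewrite -topE.
  by rewrite !ansatz_off // /fone (negPf qN0) mulr0 subr0 !addr0.
rewrite !ansatz_on // /fone -topE (inj_eq (addrI _)) (inj_eq (mulIf Q0)) eqr_nat.
have [->|ns] := eqVneq n s; first exact: Hs.
rewrite addr0.
have d0 : d1%:R != 0 :> C by rewrite d1_sq expf_neq0.
have /eqP := @conserved_coef C (2 / s%:R) d1%:R (cc w) (ce w) shifted_ca d0
  (fun n => ltac:(rewrite -iota_atE; exact: cc_recursion))
  (fun n => ltac:(rewrite -iota_atE; exact: ce_recursion))
  (fun n => ltac:(rewrite -iota_atE; exact: shifted_ca_recursion)) n.
rewrite -iota_atE mulf_eq0 subr_eq0 -iota_at_top !iota_atE.
rewrite (inj_eq (mulIf _)) ?eqr_nat ?(negPf ns); first by move/eqP.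
by rewrite mulf_neq0 ?invr_neq0 // pnatr_eq0.
Qed.

End Solved.

(** * Choosing the free parameter, and the resonances *)

Lemma top_extension w : solved_below d1 s up a0 b0 s w ->
  exists v, [/\ step_solution d1 s up a0 b0 w s v,
    (exists w', extends_at s w v w' /\ solved d1 s up a0 b0 w')
    & forall w', extends_at s w v w' -> solved d1 s up a0 b0 w' ->
      solves_system d1 (x1_of s up w') (x2_of s w') (u1_of s w') (u2_of s w')
      /\ lies_on_H0 d1 (x1_of s up w') (u1_of s w') (u2_of s w')].
Proof.
move=> w_below.
(* [K] is the part of the constant term fixed by earlier steps. The end terms add
   [2 * d1 * c_0 * c_s = 2 * eps * s * z] and [- 2 * e_0 * e_s = 4 * eps * s * z], hence the divisor
   6 in [z]. *)
pose K := d1%:R * (\sum_(1 <= k < s) cc w (s - k) * cc w k)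
  - (\sum_(1 <= k < s) ce w (s - k) * ce w k) + shifted_ca w s + 1.
pose z := - K / (6 * eps * s%:R).
pose v := top_solution w z.
have v_step : step_solution d1 s up a0 b0 w s v by exact: top_solution_step.
exists v; split=> //.
  have [w' [w'lt w'ge]] :=
    @recursion_extension s.+1 (fun i => if i == s then v else w i) isT.
  have w'_ext : extends_at s w v w'.
    split=> [i ilt|]; last by rewrite w'lt // eqxx.
    by rewrite w'lt ?(ltn_eqF ilt) //; lia.
  exists w'; split=> //; case: w'_ext => w'w w's.
  (* Up to and including step [s], the right-hand side reads only entries below [s], where [w] and
     [w'] agree. *)
  have same i : (0 < i <= s)%N -> step_solution d1 s up a0 b0 w i (w' i) ->
      step_solution d1 s up a0 b0 w' i (w' i).
    rewrite /step_solution => ilt ->; apply: Rvec_ext => [|k ki]; first by lia.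
    by rewrite w'w //; lia.
  split=> [|i i1]; first by rewrite /initial_data w'w; [exact: w_below.1 | lia].
  have [ilt|igt|->] := ltngtP i s.
  - by apply: same; [lia | rewrite w'w //; apply: w_below.2; lia].
  - by apply: w'ge => //; lia.
  by apply: same; [lia | rewrite w's].
move=> w' [w'w w's] w'_solved; split; first exact: solved_solves_system.
apply: solved_lies_on_H0 => //.
have [_ _ c_ e_] := initialE w'_solved.
have cs : cc w' s = z by rewrite /cc w's mxE.
have es : ce w' s = - 2 * eps * s%:R * z by rewrite /ce w's mxE.
have s0 : (0 < s)%N by lia.
rewrite !conv_ends // c_ e_ cs es.
have -> : shifted_ca w' s = shifted_ca w s.
  by apply: zcoef_lt => // k ks; exact: w'w.
have E1 k : (1 <= k < s)%N -> w' k = w k by move=> ks; apply: w'w; lia.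
have E2 k : (1 <= k < s)%N -> w' (s - k)%N = w (s - k)%N by move=> ks; apply: w'w; lia.
have -> : \sum_(1 <= k < s) cc w' (s - k) * cc w' k =
    \sum_(1 <= k < s) cc w (s - k) * cc w k.
  by apply: eq_big_nat => k ks; rewrite /cc (E1 _ ks) (E2 _ ks).
have -> : \sum_(1 <= k < s) ce w' (s - k) * ce w' k =
    \sum_(1 <= k < s) ce w (s - k) * ce w k.
  by apply: eq_big_nat => k ks; rewrite /ce (E1 _ ks) (E2 _ ks).
have zK : 6 * eps * s%:R * z = - K.
  by rewrite /z mulrC divfK // !mulf_neq0 ?eps_neq0 // pnatr_eq0.
apply: (etrans (y := 6 * eps * s%:R * z + K)); last by rewrite zK addNr.
by rewrite /K d1_sq; field.
Qed.

(** By the factored determinant the resonances are 0, 2 and -1. *)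
Lemma top_resonance_at : top_resonance s up a0 b0 (iota s).
Proof.
rewrite iota_at_top; split=> [|z]; rewrite /resonance det_Xmat; [|lia| |lia].
  by rewrite subrr mul0r mulr0.
move/eqP; rewrite mulf_eq0 expf_eq0 /= mulf_eq0 subr_eq0 addr_eq0.
by case/or3P => /eqP -> //; rewrite (le_trans (lerN10 _)).
Qed.

End Recursion.

Theorem proposition3p5 (R : realType) (d1 s : nat) (up : bool) (a0 b0 : R[i])
    (hd1 : (2 <= d1)%N) (hs : d1 = (s ^ 2)%N) (ha0 : a0 != 0) (hb0 : b0 != 0) :
  [/\ s%:R * Qexp s = 2,
      top_resonance s up a0 b0 (iota_at R[i] s s),
      (exists w : coefs R[i], solved_below d1 s up a0 b0 s w)
    & forall w : coefs R[i], solved_below d1 s up a0 b0 s w ->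
      [/\ compatible_at d1 s up a0 b0 w s,
          affine_of_dim 1 (step_solution d1 s up a0 b0 w s)
        & exists v : 'cV[R[i]]_4,
          [/\ step_solution d1 s up a0 b0 w s v,
              (exists w' : coefs R[i],
                 extends_at s w v w' /\ solved d1 s up a0 b0 w')
            & forall w' : coefs R[i],
                extends_at s w v w' -> solved d1 s up a0 b0 w' ->
                solves_system d1 (x1_of s up w') (x2_of s w')
                              (u1_of s w') (u2_of s w')
                /\ lies_on_H0 d1 (x1_of s up w') (u1_of s w') (u2_of s w')]]].
Proof.
have s_gt1 : (1 < s)%N by rewrite hs in hd1; nia.
split.
- by rewrite /Qexp mulrCA divff ?mulr1 // pnatr_eq0; lia.
- exact: top_resonance_at.
- exact: solved_below_exists.
move=> w hw; split; last exact: top_extension.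
  by exists (top_solution s up a0 b0 w 0); exact: top_solution_step.
exact: top_solution_affine.
Qed.
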